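(* Let $\mathcal T\in\mathbb R^{n^{\times d}}_{ps,+}$. Then $\rho_{\mathrm{trop}}(\mathcal T)=\rho_\infty(\mathcal T)$, where $\rho_\infty(\mathcal T):=\lim_{s\to\infty}\rho(\mathcal T^{\circ s})^{1/s}$.
   Context: Let $n\ge1$, $d\ge3$ be integers, $[n]=\{1,\dots,n\}$. $\mathbb R^{n^{\times d}}_{ps,+}$ is the set of tensors $\mathcal T=[t_{i_1,\dots,i_d}]$, $i_1,\dots,i_d\in[n]$, with nonnegative real entries symmetric in the last $d-1$ indices. For $x\in\mathbb C^n$, $\mathcal T(x)_i=\sum_{i_2,\dots,i_d\in[n]}t_{i,i_2,\dots,i_d}x_{i_2}\cdots x_{i_d}$, and $x^{\circ p}=(x_1^p,\dots,x_n^p)^\top$. An eigenvalue of $\mathcal T$ is $\lambda\in\mathbb C$ with $\mathcal T(x)=\lambda x^{\circ(d-1)}$ for some nonzero $x\in\mathbb C^n$; $\rho(\mathcal T)$ is the maximum modulus of the eigenvalues. For $s>0$, $\mathcal T^{\circ s}=[t_{i_1,\dots,i_d}^s]$ is the entrywise power. A nonzero nonnegative vector $u\in\mathbb R^n$ is a tropical eigenvector of $\mathcal T$ with tropical eigenvalue $\lambda$ if $\max_{i_2,\dots,i_d\in[n]}t_{i,i_2,\dots,i_d}u_{i_2}\cdots u_{i_d}=\lambda u_i^{d-1}$ for all $i\in[n]$. Tropical eigenvalues exist and are finite in number; $\rho_{\mathrm{trop}}(\mathcal T)$ is the largest one. *)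

(* Defs.v *)
From HB Require Import structures.
From mathcomp Require Import all_boot all_order all_algebra all_fingroup.
From mathcomp Require Import all_classical all_reals all_analysis.
From mathcomp Require Import complex.

Set Implicit Arguments.
Unset Strict Implicit.
Unset Printing Implicit Defensive.

Import Order.TTheory GRing.Theory Num.Theory.
Import numFieldNormedType.Exports.

Local Open Scope classical_set_scope.
Local Open Scope ring_scope.
Local Open Scope complex_scope.

(* An n x ... x n tensor of order d: the entry t_{i, i_2, ..., i_d} is [T i j],
   where [j] lists the last d - 1 indices. *)
Definition tensor (K : Type) (n d : nat) : Type :=
  'I_n -> {ffun 'I_d.-1 -> 'I_n} -> K.

Definition partially_symmetric (K : Type) (n d : nat) (T : tensor K n d) : Prop :=
  forall (i : 'I_n) (j : {ffun 'I_d.-1 -> 'I_n}) (s : 'S_d.-1),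
    T i [ffun k => j (s k)] = T i j.

Definition ps_nneg_tensor (R : realType) (n d : nat) (T : tensor R n d) : Prop :=
  (forall i j, 0 <= T i j) /\ partially_symmetric T.

Definition tensor_app (K : comPzRingType) (n d : nat)
    (T : tensor K n d) (x : 'cV[K]_n) : 'cV[K]_n :=
  \col_i \sum_(j : {ffun 'I_d.-1 -> 'I_n}) T i j * \prod_(k < d.-1) x (j k) 0.

Definition hadamard_exp (K : pzRingType) (n : nat) (x : 'cV[K]_n) (p : nat)
  : 'cV[K]_n := \col_i x i 0 ^+ p.

Definition complex_tensor (R : realType) (n d : nat) (T : tensor R n d)
  : tensor R[i] n d := fun i j => (T i j)%:C.

Definition eigenvalues (R : realType) (n d : nat) (T : tensor R n d)
  : set R[i] :=
  [set l | exists x : 'cV[R[i]]_n, x != 0 /\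
     tensor_app (complex_tensor T) x = l *: hadamard_exp x d.-1].

(* The greatest element of [A], with junk value 0 if there is none. *)
Definition maximum (R : realType) (A : set R) : R :=
  xget 0 (A `&` ubound A).

Definition rho (R : realType) (n d : nat) (T : tensor R n d) : R :=
  maximum [set Normc.normc l | l in eigenvalues T].

Definition tensor_pow (R : realType) (n d : nat) (T : tensor R n d) (s : R)
  : tensor R n d := fun i j => T i j `^ s.

(* Taking 0 as the neutral element of the maximum is harmless: T and u are
   nonnegative wherever this is used. *)
Definition trop_app (R : realType) (n d : nat)
    (T : tensor R n d) (u : 'cV[R]_n) : 'cV[R]_n :=
  \col_i \big[Num.max/0]_(j : {ffun 'I_d.-1 -> 'I_n})
    (T i j * \prod_(k < d.-1) u (j k) 0).

Definition trop_eigenvalues (R : realType) (n d : nat) (T : tensor R n d)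
  : set R :=
  [set l | exists u : 'cV[R]_n, [/\ u != 0, (forall i, 0 <= u i 0) &
     trop_app T u = l *: hadamard_exp u d.-1]].

Definition rho_trop (R : realType) (n d : nat) (T : tensor R n d) : R :=
  maximum (trop_eigenvalues T).

Definition rho_root (R : realType) (n d : nat) (T : tensor R n d) (s : R) : R :=
  rho (tensor_pow T s) `^ s^-1.

Definition rho_infty (R : realType) (n d : nat) (T : tensor R n d) : R :=
  lim (rho_root T s @[s --> +oo]).

(* Main.v *)
(* Write [m = d - 1], [N = n^m], and call [l] a subeigenvalue of a map [F] on the
   nonnegative cone if [l u^m <= F u] entrywise for some nonzero [u >= 0].
   A continuous, monotone map homogeneous of degree [m] has a greatest
   subeigenvalue, and it is an eigenvalue: if [F] is strictly monotone, maximise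
   [l] over the pairs [(l, u)] with [u] in the simplex; were the maximiser not an
   eigenvector, [(F u)^(1/m)] would admit a larger [l].  In general, perturb [F]
   by [e (u_1 + ... + u_n)^m] and let [e] tend to 0 by compactness.
   Applied to the tensor and to its tropical version (whose eigenvalues, taken
   in modulus for the former, are subeigenvalues), this identifies both
   [rho] and [rho_trop] with greatest subeigenvalues.  Since
   [(max a_j)^s <= sum a_j^s <= N (max a_j)^s], taking powers of the vectors gives
   [rho_trop T <= rho (T^s)^(1/s) <= N^(1/s) rho_trop T]. *)

Require Import Defs.
From mathcomp Require Import all_boot all_order all_algebra.
From mathcomp Require Import all_classical all_reals all_analysis.
From mathcomp Require Import complex lra.

Set Implicit Arguments.
Unset Strict Implicit.
Unset Printing Implicit Defensive.

Import Order.TTheory GRing.Theory Num.Theory.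
Import numFieldNormedType.Exports.

Local Open Scope classical_set_scope.
Local Open Scope ring_scope.

(** * Continuity of real functions built from sums, products and maxima *)

Section Continuity.
Variables (R : realType) (T : topologicalType).

Lemma continuousD_fun (f g : T -> R) :
  continuous f -> continuous g -> continuous (fun x => f x + g x).
Proof. by move=> cf cg x; apply: cvgD; [exact: cf | exact: cg]. Qed.

Lemma continuousB_fun (f g : T -> R) :
  continuous f -> continuous g -> continuous (fun x => f x - g x).
Proof. by move=> cf cg x; apply: cvgB; [exact: cf | exact: cg]. Qed.

Lemma continuousM_fun (f g : T -> R) :
  continuous f -> continuous g -> continuous (fun x => f x * g x).
Proof. by move=> cf cg x; apply: cvgM; [exact: cf | exact: cg]. Qed.

Lemma continuousX_fun (f : T -> R) m :
  continuous f -> continuous (fun x => f x ^+ m).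
Proof.
move=> cf x; apply: (@continuous_comp _ _ _ f (fun y : R => y ^+ m)).
  exact: cf.
exact: exprn_continuous.
Qed.

Lemma continuous_sum (I : Type) (r : seq I) (f : I -> T -> R) :
  (forall i, continuous (f i)) -> continuous (fun x => \sum_(i <- r) f i x).
Proof.
move=> cf; apply: continuous_big => [x|i _]; last exact: cf.
by apply: cvgD; [exact: cvg_fst | exact: cvg_snd].
Qed.

Lemma continuous_prod (I : Type) (r : seq I) (f : I -> T -> R) :
  (forall i, continuous (f i)) -> continuous (fun x => \prod_(i <- r) f i x).
Proof.
move=> cf; apply: continuous_big => [x|i _]; last exact: cf.
by apply: cvgM; [exact: cvg_fst | exact: cvg_snd].
Qed.

Lemma continuous_bigmax (I : Type) (r : seq I) (f : I -> T -> R) :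
  (forall i, continuous (f i)) ->
  continuous (fun x => \big[Num.max/0]_(i <- r) f i x).
Proof.
move=> cf; apply: (@continuous_big R) => [|i _]; last exact: cf.
exact: max_continuous.
Qed.

Lemma closed_le_fun (f g : T -> R) :
  continuous f -> continuous g -> closed [set x | f x <= g x].
Proof.
move=> cf cg; have -> : [set x | f x <= g x] =
    (fun x => f x - g x) @^-1` [set y | y <= 0].
  by apply/seteqP; split=> x /=; rewrite subr_le0.
apply: preimage_closed; last exact: closed_le.
by move=> x _; apply: continuousB_fun.
Qed.

End Continuity.

(** * Compactness of the standard simplex *)

Section Simplex.
Variables (R : realType) (n : nat).

Definition simplex : set 'rV[R]_n :=
  [set u | (forall i, 0 <= u 0 i) /\ \sum_i u 0 i = 1].

Lemma simplex_compact : compact simplex.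
Proof.
have -> : simplex = [set v : 'rV[R]_n | forall i, `[0, 1]%classic (v ord0 i)] `&`
    (fun v : 'rV[R]_n => \sum_i v 0 i) @^-1` [set y | y = 1].
  apply/seteqP; split=> v /= [v0 v1]; split=> // i; last first.
    by have := v0 i; rewrite in_itv/= => /andP[].
  rewrite in_itv/= v0/= -v1 (bigD1 i)//= lerDl sumr_ge0// => j _; exact: v0.
apply: compact_closedI.
  apply: (@rV_compact R n (fun=> `[0, 1]%classic)) => i.
  exact: segment_compact.
apply: preimage_closed; last exact: closed_eq.
by move=> x _; apply: continuous_sum => i; exact: coord_continuous.
Qed.

End Simplex.

(** * Nonlinear Perron-Frobenius theory on the nonnegative cone *)

Section PerronFrobenius.
Variables (R : realType) (n m : nat).
Implicit Types (F : 'rV[R]_n -> 'I_n -> R) (u v : 'rV[R]_n).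

Definition nonneg u := forall i, 0 <= u 0 i.

Definition subeigenvalue F (l : R) := exists u,
  [/\ nonneg u, u != 0 & forall i, l * u 0 i ^+ m <= F u i].

Definition monotone_map F := forall u v, nonneg u ->
  (forall i, u 0 i <= v 0 i) -> forall i, F u i <= F v i.

(** As for positive matrices, an increase in one coordinate of the argument must be felt in every
    coordinate of the value. *)
Definition strictly_monotone_map F := forall u v, nonneg u ->
  (forall i, u 0 i <= v 0 i) -> u != v -> forall i, F u i < F v i.

Definition homogeneous_map F := forall c u, 0 <= c -> nonneg u ->
  forall i, F (c *: u) i = c ^+ m * F u i.

Definition continuous_map F := forall i, continuous (F ^~ i).

Lemma sum_gt0 u : nonneg u -> u != 0 -> 0 < \sum_i u 0 i.
Proof.
move=> u0 uN0; rewrite lt_def sumr_ge0 ?andbT//.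
apply: contra uN0 => /eqP s0; apply/eqP/rowP => i; rewrite mxE.
by apply: (psumr_eq0P _ s0) => // j _; exact: u0.
Qed.

Lemma simplex_neq0 u : simplex u -> u != 0.
Proof.
move=> [_ u1]; apply: contra_eq_neq u1 => ->.
by rewrite big1 ?(eq_sym _ 1) ?oner_neq0// => i _; rewrite mxE.
Qed.

Hypothesis m_gt0 : (0 < m)%N.

Lemma homogeneous_ge0 F u : monotone_map F -> homogeneous_map F ->
  nonneg u -> forall i, 0 <= F u i.
Proof.
move=> mF hF u0 i; have z0 : nonneg 0 by move=> j; rewrite mxE.
have <- : F 0 i = 0.
  by rewrite -(scale0r (0 : 'rV[R]_n)) hF// expr0n eqn0Ngt m_gt0 mul0r.
by apply: mF => // j; rewrite mxE; exact: u0.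
Qed.

(** Both sides of the inequality scale by [c ^+ m], so the witness can be divided by its coordinate
    sum. *)
Lemma subeigenvalue_simplex F l : homogeneous_map F -> subeigenvalue F l ->
  exists u, simplex u /\ forall i, l * u 0 i ^+ m <= F u i.
Proof.
move=> hF [u [u0 uN0 lu]]; have s0 := sum_gt0 u0 uN0.
have t0 := ltW s0; exists ((\sum_i u 0 i)^-1 *: u); split; first split.
- by move=> i; rewrite mxE mulr_ge0 ?invr_ge0// u0.
- under eq_bigr do rewrite mxE.
  by rewrite -mulr_sumr mulVf// gt_eqF.
move=> i; rewrite hF ?invr_ge0// mxE exprMn mulrCA ler_wpM2l//.
by rewrite exprn_ge0 ?invr_ge0.
Qed.

(** At an index [k] where [u] is largest, [u] lies below [u_k] times the all-ones vector, whence
    [l u_k^m <= u_k^m F(1)_k]. Summing over all indices removes the dependence on [k]. *)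
Lemma subeigenvalue_le F l : monotone_map F -> homogeneous_map F ->
  subeigenvalue F l -> l <= \sum_i F (const_mx 1) i.
Proof.
move=> mF hF [u [u0 uN0 lu]].
have [k uk] : exists k, forall j, u 0 j <= u 0 k.
  have [k _] : exists k, u 0 k != 0.
    apply/existsP; apply: contraT; rewrite negb_exists => /forallP z.
    case/negP: uN0; apply/eqP/rowP => i; rewrite mxE; apply/eqP.
    by have := z i; rewrite negbK.
  exists [arg max_(i > k) u 0 i]%O.
  by case: arg_maxP => // i _ ui j; exact: ui.
have uk0 : 0 < u 0 k.
  rewrite lt_def u0 andbT; apply: contra uN0 => /eqP z.
  by apply/eqP/rowP => i; rewrite mxE; apply/le_anti; rewrite u0 -z uk.
have o0 : nonneg (const_mx 1) by move=> i; rewrite mxE.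
apply: (@le_trans _ _ (F (const_mx 1) k)).
  rewrite -(ler_pM2l (exprn_gt0 m uk0)) -hF ?u0// mulrC.
  by apply: (le_trans (lu k)); apply: mF => // i; rewrite !mxE mulr1.
rewrite (bigD1 k)//= lerDl sumr_ge0// => i _; exact: homogeneous_ge0.
Qed.

Lemma strict_perron F : (0 < n)%N -> continuous_map F ->
    strictly_monotone_map F -> homogeneous_map F ->
  exists l u, [/\ 0 <= l, simplex u, (forall i, F u i = l * u 0 i ^+ m) &
    forall l', subeigenvalue F l' -> l' <= l].
Proof.
move=> n_gt0 cF sF hF.
have mF : monotone_map F.
  move=> u v u0 uv i; have [->//|neq_uv] := eqVneq u v.
  exact/ltW/sF.
set B := \sum_i F (const_mx 1) i.
pose K := (`[0, B]%classic `*` simplex (R := R) (n := n)) `&`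
  \bigcap_(i in [set: 'I_n])
    [set p : R * 'rV[R]_n | p.1 * p.2 0 i ^+ m <= F p.2 i].
have KP l u : 0 <= l -> simplex u -> (forall i, l * u 0 i ^+ m <= F u i) ->
    K (l, u).
  move=> l0 su lu; split; last by move=> i _; exact: lu.
  split=> //=; rewrite in_itv/= l0/=; apply: subeigenvalue_le => //.
  by exists u; split=> //; [case: su | exact: simplex_neq0].
have cK : compact K.
  apply: compact_closedI.
    apply: compact_setX; [exact: segment_compact | exact: simplex_compact].
  apply: closed_bigI => i _; apply: closed_le_fun.
    apply: continuousM_fun => [x|]; first exact: cvg_fst.
    apply: continuousX_fun => x.
    apply: (@continuous_comp _ _ _ snd (fun u : 'rV[R]_n => u 0 i)).
      exact: cvg_snd.
    exact: coord_continuous.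
  move=> x; apply: (@continuous_comp _ _ _ snd (F ^~ i)); first exact: cvg_snd.
  exact: cF.
(* The value [0] paired with a vertex of the simplex lies in [K]. *)
have K0 : K !=set0.
  exists (0, delta_mx 0 (Ordinal n_gt0)); apply: KP => //.
    split=> [i|]; first by rewrite mxE; case: (_ && _).
    rewrite (bigD1 (Ordinal n_gt0))//= mxE !eqxx big1 ?addr0// => i ni.
    by rewrite mxE (negbTE ni) andbF.
  move=> i; rewrite mul0r homogeneous_ge0// => j.
  by rewrite mxE; case: (_ && _).
have [|[l u] /set_mem[[/= lB [u0 u1]] lu] lmax] :=
    compact_EVT_max (f := fst) K0 cK.
  by apply: continuous_subspaceT => x; exact: cvg_fst.
have {lB} l0 : 0 <= l by move: lB; rewrite in_itv/= => /andP[].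
have {}lu i : l * u 0 i ^+ m <= F u i by exact: lu.
have {}lmax l' : subeigenvalue F l' -> l' <= l.
  (* A negative [l'] gives no point of [K], but it lies below [l >= 0] anyway. *)
  move=> sl'; have [l'0|/ltW l'0] := leP 0 l'; last exact: le_trans l0.
  have [v [sv l'v]] := subeigenvalue_simplex hF sl'.
  by apply: (lmax (l', v)); apply/mem_set/KP.
exists l, u; split=> //; apply/eqfunP; apply: contraT.
rewrite negb_forall => /existsP[k neq_k].
have mR0 : m%:R != 0 :> R by rewrite pnatr_eq0 -lt0n.
(* [y = (F u)^(1/m)] has [F y > l y^m] in every coordinate if [u] is not an
   eigenvector. *)
pose rt (a : R) := a `^ (m%:R^-1).
have rt0 a : 0 <= rt a by exact: powR_ge0.
have rtK a : 0 <= a -> rt a ^+ m = a.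
  by move=> a0; rewrite -powR_mulrn// -powRrM mulVf// powRr1.
have Fu0 i : 0 <= F u i by exact: homogeneous_ge0.
pose y : 'rV[R]_n := \row_i rt (F u i).
have y0 : nonneg y by move=> i; rewrite mxE.
have yE i : y 0 i ^+ m = F u i by rewrite mxE rtK.
have cu0 : nonneg (rt l *: u) by move=> i; rewrite mxE mulr_ge0// u0.
have cuE i : (rt l *: u) 0 i ^+ m = l * u 0 i ^+ m by rewrite mxE exprMn rtK.
have cuy i : (rt l *: u) 0 i <= y 0 i.
  rewrite -(ler_pXn2r m_gt0) ?nnegrE ?cu0 ?y0//.
  by rewrite cuE yE.
have neq_cuy : rt l *: u != y.
  apply: contra neq_k => /eqP e; rewrite -yE -e cuE//.
have yN0 : y != 0.
  apply: contra neq_cuy => /eqP e; rewrite e; apply/eqP/rowP => i.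
  by apply/le_anti; rewrite -{1}e cuy mxE cu0.
(* Here [l y^m = l F u = F (rt l *: u)], and strict monotonicity applies because [rt l *: u <= y]
   and the two differ. *)
have lty i : l * y 0 i ^+ m < F y i.
  by rewrite yE -[X in X * _]rtK// -hF//; exact: sF.
pose Y := \sum_i y 0 i ^+ m.
have yY i : y 0 i ^+ m <= Y.
  rewrite /Y (bigD1 i)//= lerDl sumr_ge0// => j _; exact: exprn_ge0.
have Y0 : 0 < Y.
  rewrite lt_def sumr_ge0 ?andbT; last by move=> i _; exact: exprn_ge0.
  apply: contra yN0 => /eqP s0; apply/eqP/rowP => i; rewrite [RHS]mxE.
  have /eqP : y 0 i ^+ m = 0.
    by apply: (psumr_eq0P _ s0) => // j _; exact: exprn_ge0.
  by rewrite expf_eq0 => /andP[_ /eqP].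
(* The smallest gap; the default [1] keeps it positive. As each [y_i^m] is at most [Y], raising [l]
   by [dl / Y] costs at most [dl] in every coordinate. *)
pose dl := \big[Num.min/1]_i (F y i - l * y 0 i ^+ m).
have dl0 : 0 < dl by apply: lt_bigmin => // i _; rewrite subr_gt0.
have /lmax : subeigenvalue F (l + dl / Y).
  exists y; split=> // i; rewrite mulrDl -lerBrDl.
  apply: (@le_trans _ _ dl); last exact: bigmin_le.
  by rewrite mulrAC ler_pdivrMr// ler_pM2l.
by rewrite gerDl leNgt divr_gt0.
Qed.

Lemma nonlinear_perron F : (0 < n)%N -> continuous_map F ->
    monotone_map F -> homogeneous_map F ->
  exists l u, [/\ 0 <= l, simplex u, (forall i, F u i = l * u 0 i ^+ m) &
    forall l', subeigenvalue F l' -> l' <= l].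
Proof.
move=> n_gt0 cF mF hF.
pose Fe (e : R) u i := F u i + e * (\sum_j u 0 j) ^+ m.
have csum : continuous (fun u : 'rV[R]_n => (\sum_j u 0 j) ^+ m).
  by apply/continuousX_fun/continuous_sum => j; exact: coord_continuous.
have hFe e : homogeneous_map (Fe e).
  move=> c u c0 u0 i; rewrite /Fe hF//.
  under eq_bigr do rewrite mxE.
  by rewrite -mulr_sumr exprMn mulrDr mulrCA.
(* The perturbation is the same in every coordinate and depends on the sum of [u], which grows
   strictly as soon as one entry does. *)
have sFe e : 0 < e -> strictly_monotone_map (Fe e).
  move=> e0 u v u0 uv neq_uv i; apply: ler_ltD; first exact: mF.
  rewrite ltr_pM2l// ltrXn2r -?lt0n// ?sumr_ge0//.
    rewrite -subr_gt0 -sumrB; have := @sum_gt0 (v - u).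
    under eq_bigr do rewrite !mxE.
    apply; first by move=> j; rewrite !mxE subr_ge0.
    by rewrite subr_eq0 eq_sym.
have perron_e e : 0 < e ->
    exists l u, [/\ 0 <= l, simplex u, (forall i, Fe e u i = l * u 0 i ^+ m) &
      forall l', subeigenvalue (Fe e) l' -> l' <= l].
  move=> e0; apply: strict_perron => //; last exact: sFe.
  move=> i; rewrite /Fe; apply: continuousD_fun; first exact: cF.
  apply: (continuousM_fun _ csum). exact: cst_continuous.
have subFe e l : 0 <= e -> subeigenvalue F l -> subeigenvalue (Fe e) l.
  move=> e0 [u [u0 uN0 lu]]; exists u; split=> // i.
  by rewrite (le_trans (lu i))// lerDl mulr_ge0// exprn_ge0// sumr_ge0.
have mFe e : 0 <= e -> monotone_map (Fe e).
  move=> e0 u v u0 uv i; apply: lerD; first exact: mF.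
  rewrite ler_wpM2l// lerXn2r ?nnegrE ?sumr_ge0// => [j _|].
    exact: le_trans (u0 j) (uv j).
  by apply: ler_sum => j _; exact: uv.
(* Since [Fe e <= Fe 1] on the cone for [e <= 1], this single bound serves all perturbed eigenvalues
   with [0 < e <= 1]. *)
set B := \sum_i Fe 1 (const_mx 1) i.
(* Dominating every subeigenvalue of [F] is a closed condition on [l]. Building it into [K] makes
   maximality survive the limit. *)
pose K := (`[0, B]%classic `*` simplex (R := R) (n := n)) `&`
  \bigcap_(l in subeigenvalue F) [set p : R * 'rV[R]_n | l <= p.1].
have cK : compact K.
  apply: compact_closedI.
    apply: compact_setX; [exact: segment_compact | exact: simplex_compact].
  apply: closed_bigI => l _; apply: closed_le_fun => x; first exact: cvg_cst.
  exact: cvg_fst.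
pose g (p : R * 'rV[R]_n) := \sum_i `|F p.2 i - p.1 * p.2 0 i ^+ m|.
have cg : continuous g.
  apply: continuous_sum => i x; apply: cvg_norm; move: x; apply: continuousB_fun.
    move=> x; apply: (@continuous_comp _ _ _ snd (F ^~ i)); first exact: cvg_snd.
    exact: cF.
  apply: continuousM_fun => [x|]; first exact: cvg_fst.
  apply: continuousX_fun => x.
  apply: (@continuous_comp _ _ _ snd (fun u : 'rV[R]_n => u 0 i)).
    exact: cvg_snd.
  exact: coord_continuous.
have approx e : 0 < e <= 1 -> exists2 p, K p & g p <= n%:R * e.
  move=> /andP[e0 e1]; have [l [u [l0 su eu lmax]]] := perron_e e e0.
  have [u0 u1] := su; exists (l, u).
    split=> [|l' sl'] /=; last by apply: lmax; exact: subFe (ltW e0) _.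
    split=> //=; rewrite in_itv/= l0/=.
    apply: subeigenvalue_le (mFe 1 ler01) (hFe 1) _.
    exists u; split=> //; first exact: simplex_neq0.
    move=> i; rewrite -eu lerD2l ler_wpM2r// exprn_ge0// sumr_ge0//.
  (* On the simplex the perturbation equals [e], so each of the [n] coordinates has defect exactly
     [e]. *)
  rewrite /g /= -[n in n%:R]card_ord -sum1_card natr_sum mulr_suml.
  apply: ler_sum => i _; rewrite -eu /Fe u1 expr1n mulr1 mul1r.
  by rewrite opprD addNKr normrN gtr0_norm.
have K0 : K !=set0.
  by have [|p Kp _] := approx 1; [rewrite ltr01 lexx | exists p].
(* Minimising the defect [g] over [K] replaces the extraction of a convergent subsequence as [e]
   tends to 0. *)
have [|[l u] /set_mem[[/= lB su] lmax] gmin] := compact_EVT_min K0 cK (f := g).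
  exact: continuous_subspaceT.
have g0 : g (l, u) = 0.
  apply/le_anti/andP; split; last by apply: sumr_ge0.
  rewrite leNgt; apply/negP => glu.
  have n0 : 0 < n%:R :> R by rewrite ltr0n.
  (* With this [e], [approx] produces a defect of at most half the supposedly positive minimum; the
     cap [1] keeps [e] in its range. *)
  pose e := Num.min 1 (g (l, u) / (n%:R * 2)).
  have e0 : 0 < e by rewrite lt_min ltr01 divr_gt0// mulr_gt0.
  have [|p /mem_set/gmin le1 le2] := approx e; first by rewrite e0 ge_min lexx.
  have : n%:R * e <= g (l, u) / 2.
    rewrite -ler_pdivlMl// mulrC -mulrA -invfM (mulrC 2) ge_min lexx orbT//.
  lra.
exists l, u; split=> //; first by move: lB; rewrite in_itv/= => /andP[].
move=> i; apply/eqP; rewrite -subr_eq0 -normr_eq0; apply/eqP.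
by apply: (psumr_eq0P _ g0).
Qed.

End PerronFrobenius.

(** * Real powers, and comparison of sums with maxima *)

Section RealPowers.
Variables (R : realType) (s : R).

Lemma powR_prod (I : Type) (r : seq I) (f : I -> R) :
  (forall i, 0 <= f i) -> (\prod_(i <- r) f i) `^ s = \prod_(i <- r) f i `^ s.
Proof.
move=> f0; elim: r => [|i r IHr]; first by rewrite !big_nil powR1.
by rewrite !big_cons powRM ?IHr// prodr_ge0.
Qed.

Lemma powRXn (a : R) m : 0 <= a -> (a ^+ m) `^ s = (a `^ s) ^+ m.
Proof. by move=> a0; rewrite -(powR_mulrn m a0) powRAC powR_mulrn ?powR_ge0. Qed.

Hypothesis s_gt0 : 0 < s.

Lemma powR_bigmax_le_sum (I : Type) (r : seq I) (f : I -> R) :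
  (\big[Num.max/0]_(i <- r) f i) `^ s <= \sum_(i <- r) f i `^ s.
Proof.
elim: r => [|i r IHr]; first by rewrite !big_nil powR0 ?gt_eqF.
rewrite !big_cons; case: (leP (f i)) => _.
  by apply: (le_trans IHr); rewrite lerDr powR_ge0.
by rewrite lerDl (le_trans _ IHr) ?powR_ge0.
Qed.

Lemma sum_powR_le_bigmax (I : finType) (f : I -> R) : (forall i, 0 <= f i) ->
  \sum_i f i `^ s <= #|I|%:R * (\big[Num.max/0]_i f i) `^ s.
Proof.
move=> f0; rewrite -sum1_card natr_sum mulr_suml.
apply: ler_sum => i _; rewrite mul1r.
apply: ge0_ler_powR; rewrite ?nnegrE ?(ltW s_gt0)//; last exact: le_bigmax.
exact: le_trans (f0 i) (le_bigmax 0 f i).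
Qed.

Lemma powRK (a : R) : 0 <= a -> (a `^ s) `^ s^-1 = a.
Proof. by move=> a0; rewrite -powRrM divff ?gt_eqF// powRr1. Qed.

Lemma powRVK (a : R) : 0 <= a -> (a `^ s^-1) `^ s = a.
Proof. by move=> a0; rewrite -powRrM mulVf ?gt_eqF// powRr1. Qed.

End RealPowers.

(** Write the power as [expR (s^-1 * ln a)] and use continuity of the exponential at 0. *)
Lemma cvg_powR_invr (R : realType) (a : R) : 0 < a ->
  a `^ s^-1 @[s --> +oo] --> (1 : R).
Proof.
move=> a0; rewrite -expR0.
have -> : (fun s => a `^ s^-1) = (fun s => expR (s^-1 * ln a)).
  by apply/funext => s; rewrite /powR gt_eqF.
apply: (@cvg_comp _ _ _ (fun s : R => s^-1 * ln a) expR _ (nbhs (0 : R)));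
  last exact: continuous_expR.
rewrite -(mul0r (ln a)); apply: cvgM; last exact: cvg_cst.
apply/gtr0_cvgV0; first by apply: nbhs_pinfty_gt; rewrite num_real.
exact: cvg_id.
Qed.

Lemma maximum_eq (R : realType) (A : set R) a :
  A a -> ubound A a -> maximum A = a.
Proof.
move=> Aa ubAa; apply: xget_unique => // b [Ab ubAb].
by apply/le_anti; rewrite ubAa// ubAb.
Qed.

(** * The real-valued modulus of complex numbers *)

Section ComplexModulus.
Variable R : realType.

Lemma normc_real (a : R) : 0 <= a -> Normc.normc (a%:C)%C = a.
Proof.
by move=> a0; rewrite /Normc.normc/= expr0n/= addr0 sqrtr_sqr ger0_norm.
Qed.

Lemma normcX (z : R[i]) k : Normc.normc (z ^+ k) = Normc.normc z ^+ k.
Proof.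
elim: k => [|k IHk]; first by rewrite !expr0 Normc.normc1.
by rewrite !exprS Normc.normcM IHk.
Qed.

Lemma le_normc_sum (I : Type) (r : seq I) (f : I -> R[i]) :
  Normc.normc (\sum_(i <- r) f i) <= \sum_(i <- r) Normc.normc (f i).
Proof.
elim: r => [|i r IHr]; first by rewrite !big_nil Normc.normc0.
by rewrite !big_cons (le_trans (le_normcD _ _))// lerD2l.
Qed.

End ComplexModulus.

(** * The tensor and its tropical version as maps on the cone *)

Section TensorMaps.
Variables (R : realType) (n d : nat).
Implicit Types (T : tensor R n d) (u v : 'rV[R]_n).
Let m := d.-1.

(** The transpose passes from the row vectors of the compactness arguments to the column vectors of
    the eigenvalue problem. *)
Definition tensor_map T u i := tensor_app T u^T i 0.
Definition trop_map T u i := trop_app T u^T i 0.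

Definition monomial T u i (j : {ffun 'I_m -> 'I_n}) :=
  T i j * \prod_(k < m) u 0 (j k).

Lemma tensor_mapE T u i : tensor_map T u i = \sum_j monomial T u i j.
Proof.
by rewrite /tensor_map mxE; apply: eq_bigr => j _;
   congr (_ * _); apply: eq_bigr => k _; rewrite mxE.
Qed.

Lemma trop_mapE T u i :
  trop_map T u i = \big[Num.max/0]_j monomial T u i j.
Proof.
by rewrite /trop_map mxE; apply: eq_bigr => j _;
   congr (_ * _); apply: eq_bigr => k _; rewrite mxE.
Qed.

Lemma monomial_continuous T i j : continuous (fun u => monomial T u i j).
Proof.
apply: continuousM_fun; first exact: cst_continuous.
by apply: continuous_prod => k; exact: coord_continuous.
Qed.

Lemma monomialZ T c u i j : monomial T (c *: u) i j = c ^+ m * monomial T u i j.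
Proof.
rewrite /monomial mulrCA; congr (_ * _).
under eq_bigr do rewrite mxE.
by rewrite big_split/= prodr_const card_ord.
Qed.

Lemma tensor_map_continuous T : continuous_map (tensor_map T).
Proof.
move=> i; have -> : tensor_map T ^~ i = fun u => \sum_j monomial T u i j.
  by apply/funext => u; exact: tensor_mapE.
by apply: continuous_sum => j; exact: monomial_continuous.
Qed.

Lemma trop_map_continuous T : continuous_map (trop_map T).
Proof.
move=> i.
have -> : trop_map T ^~ i = fun u => \big[Num.max/0]_j monomial T u i j.
  by apply/funext => u; exact: trop_mapE.
by apply: continuous_bigmax => j; exact: monomial_continuous.
Qed.

Lemma tensor_map_homogeneous T : homogeneous_map m (tensor_map T).
Proof.
move=> c u _ _ i; rewrite !tensor_mapE mulr_sumr.
by apply: eq_bigr => j _; exact: monomialZ.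
Qed.

Lemma trop_map_homogeneous T : homogeneous_map m (trop_map T).
Proof.
move=> c u c0 _ i; rewrite !trop_mapE.
under eq_bigr do rewrite monomialZ.
elim/big_rec2: _ => [|j x y _ ->]; first by rewrite mulr0.
by rewrite maxr_pMr// exprn_ge0.
Qed.

Section Nonneg.
Variable T : tensor R n d.
Hypothesis T_ge0 : forall i j, 0 <= T i j.

Lemma monomial_ge0 u i j : nonneg u -> 0 <= monomial T u i j.
Proof. by move=> u0; rewrite mulr_ge0// prodr_ge0. Qed.

Lemma le_monomial u v i j : nonneg u -> (forall i, u 0 i <= v 0 i) ->
  monomial T u i j <= monomial T v i j.
Proof.
move=> u0 uv; rewrite ler_wpM2l//; apply: ler_prod => k _.
by rewrite u0 uv.
Qed.

Lemma tensor_map_monotone : monotone_map (tensor_map T).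
Proof.
move=> u v u0 uv i; rewrite !tensor_mapE.
by apply: ler_sum => j _; exact: le_monomial.
Qed.

Lemma trop_map_monotone : monotone_map (trop_map T).
Proof.
move=> u v u0 uv i; rewrite !trop_mapE.
by apply: le_bigmax2 => j _; exact: le_monomial.
Qed.

Lemma trop_map_ge0 u i : 0 <= trop_map T u i.
Proof.
by rewrite trop_mapE; elim/big_rec: _ => // j x _ x0; rewrite le_max x0 orbT.
Qed.

(** Real powers are multiplicative on nonnegative numbers. This links [T] at [u] to [tensor_pow T s]
    at the entrywise power of [u]. *)
Lemma monomial_powR s u i j : nonneg u ->
  monomial (tensor_pow T s) (map_mx (fun a => a `^ s) u) i j = monomial T u i j `^ s.
Proof.
move=> u0; rewrite /monomial powRM ?prodr_ge0// powR_prod//.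
by congr (_ * _); apply: eq_bigr => k _; rewrite mxE.
Qed.

(** Raise the inequalities for [u] to the power [s] and bound the power of the maximum by the sum of
    powers; the entrywise power of [u] is the witness. *)
Lemma subeigenvalue_trop_pow s l : 0 < s -> 0 <= l ->
  subeigenvalue m (trop_map T) l ->
  subeigenvalue m (tensor_map (tensor_pow T s)) (l `^ s).
Proof.
move=> s0 l0 [u [u0 uN0 lu]]; exists (map_mx (fun a => a `^ s) u); split.
- by move=> i; rewrite mxE powR_ge0.
- apply: contra uN0 => /eqP e; apply/eqP/rowP => i.
  by move/rowP/(_ i): e; rewrite !mxE => /powR_eq0_eq0.
move=> i; rewrite tensor_mapE; under eq_bigr do rewrite monomial_powR//.
apply: le_trans (powR_bigmax_le_sum s0 _ _).
rewrite -trop_mapE mxE -powRXn// -powRM ?exprn_ge0//.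
by rewrite ge0_ler_powR ?nnegrE ?mulr_ge0 ?exprn_ge0 ?trop_map_ge0// ltW.
Qed.

(** The witness is the entrywise [s^-1]-th power of [u]. Replacing a sum by its largest term costs a
    factor equal to the number of monomials, hence the division of [l]. *)
Lemma subeigenvalue_pow_trop s l : 0 < s -> 0 <= l -> (0 < n)%N ->
  subeigenvalue m (tensor_map (tensor_pow T s)) l ->
  subeigenvalue m (trop_map T) ((l / #|{ffun 'I_m -> 'I_n}|%:R) `^ s^-1).
Proof.
move=> s0 l0 n0 [u [u0 uN0 lu]].
have N0 : 0 < #|{ffun 'I_m -> 'I_n}|%:R :> R.
  by rewrite ltr0n; apply/card_gt0P; exists [ffun=> Ordinal n0].
pose w := map_mx (fun a => a `^ s^-1) u.
have w0 : nonneg w by move=> i; rewrite mxE powR_ge0.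
have wK : map_mx (fun a => a `^ s) w = u by apply/rowP => i; rewrite !mxE powRVK.
exists w; split=> // [|i].
  apply: contra uN0 => /eqP w_0; apply/eqP/rowP => i.
  by rewrite -wK w_0 !mxE powR0 ?gt_eqF.
(* Both sides become [s^-1]-th powers, so that only their bases need comparing. *)
rewrite -[leRHS](powRK s0) ?trop_map_ge0//.
rewrite -[w 0 i ^+ m](powRK s0) ?exprn_ge0//.
rewrite -powRM ?divr_ge0 ?powR_ge0// ?ler0n//.
apply: ge0_ler_powR; rewrite ?nnegrE ?invr_ge0 ?powR_ge0 ?(ltW s0)//.
  by rewrite mulr_ge0 ?divr_ge0 ?powR_ge0.
rewrite mulrAC ler_pdivrMr// mulrC powRXn//.
have := lu i; rewrite tensor_mapE -wK; under eq_bigr do rewrite monomial_powR//.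
rewrite mxE mulrC => /le_trans; apply.
rewrite [leRHS]mulrC trop_mapE; apply: sum_powR_le_bigmax => // j.
exact: monomial_ge0.
Qed.

Hypotheses (n_gt0 : (0 < n)%N) (m_gt0 : (0 < m)%N).

(** The Perron eigenvalue of [trop_map T] is a tropical eigenvalue, and every tropical eigenvalue is
    a subeigenvalue; so the maximum is attained there. *)
Lemma rho_trop_max : [/\ 0 <= rho_trop T,
  subeigenvalue m (trop_map T) (rho_trop T) &
  forall l, subeigenvalue m (trop_map T) l -> l <= rho_trop T].
Proof.
have [l [u [l0 su eu lmax]]] := nonlinear_perron m_gt0 n_gt0
  (@trop_map_continuous T) trop_map_monotone (@trop_map_homogeneous T).
have [u0 _] := su; have uN0 := simplex_neq0 su.
suff -> : rho_trop T = l by split=> //; exists u; split=> // i; rewrite eu.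
apply: maximum_eq.
  exists u^T; split.
  - by rewrite -trmx0 (inj_eq trmx_inj).
  - by move=> i; rewrite mxE.
  - by apply/colP => i; rewrite !mxE -eu /trop_map mxE.
move=> l' [v [vN0 v0 ev]]; apply: lmax; exists v^T; split.
- by move=> i; rewrite mxE.
- by rewrite -trmx0 (inj_eq trmx_inj).
by move=> i; rewrite /trop_map trmxK ev !mxE.
Qed.

Lemma rho_max : [/\ 0 <= rho T,
  subeigenvalue m (tensor_map T) (rho T) &
  forall l, subeigenvalue m (tensor_map T) l -> l <= rho T].
Proof.
have [l [u [l0 su eu lmax]]] := nonlinear_perron m_gt0 n_gt0
  (@tensor_map_continuous T) tensor_map_monotone (@tensor_map_homogeneous T).
have [u0 _] := su; have uN0 := simplex_neq0 su.
suff -> : rho T = l by split=> //; exists u; split=> // i; rewrite eu.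
apply: maximum_eq.
  exists (l%:C)%C; last exact: normc_real.
  exists (map_mx (real_complex R) u^T); split.
    by rewrite map_mx_eq0 -trmx0 (inj_eq trmx_inj).
  apply/colP => i; rewrite !mxE -rmorphXn -rmorphM -eu tensor_mapE rmorph_sum.
  apply: eq_bigr => j _; rewrite /monomial rmorphM rmorph_prod; congr (_ * _).
  by apply: eq_bigr => k _; rewrite !mxE.
move=> _ [z [x [xN0 ex]] <-]; apply: lmax.
(* By the triangle inequality, the moduli of a complex eigenvector satisfy
   [|z| |x_i|^m = |T(x)_i| <= T(|x|)_i]. *)
exists (\row_i Normc.normc (x i 0)); split.
- by move=> i; rewrite mxE; case: (x i 0) => a b; exact: sqrtr_ge0.
- apply: contra xN0 => /eqP e; apply/eqP/colP => i.
  by move/rowP/(_ i): e; rewrite !mxE => /Normc.eq0_normc.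
move=> i; rewrite mxE -normcX -Normc.normcM.
have := congr1 (fun y : 'cV[R[i]]_n => y i 0) ex; rewrite !mxE => <-.
apply: (le_trans (le_normc_sum _ _)); rewrite tensor_mapE.
apply: ler_sum => j _; rewrite Normc.normcM normc_real//.
rewrite (big_morph _ (@Normc.normcM R) (@Normc.normc1 R)).
by rewrite /monomial; under [X in _ <= _ * X]eq_bigr do rewrite mxE.
Qed.

End Nonneg.

End TensorMaps.

(** * Squeezing the roots of the spectral radii *)

Theorem theorem23 (R : realType) (n d : nat) (n_ge1 : (1 <= n)%N)
    (d_ge3 : (3 <= d)%N) (T : tensor R n d) (psT : ps_nneg_tensor T) :
  cvg (rho_root T s @[s --> +oo]) /\ rho_trop T = rho_infty T.
Proof.
have [T0 _] := psT.
have m0 : (0 < d.-1)%N by case: d d_ge3 {T psT T0} => [|[]].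
pose N : R := #|{ffun 'I_d.-1 -> 'I_n}|%:R.
have N0 : 0 < N.
  by rewrite ltr0n; apply/card_gt0P; exists [ffun=> Ordinal n_ge1].
have [t0 st tmax] := rho_trop_max T0 n_ge1 m0.
have bounds s : 0 < s ->
    rho_trop T <= rho_root T s <= N `^ s^-1 * rho_trop T.
  move=> s0; have Ts0 i j : 0 <= tensor_pow T s i j by exact: powR_ge0.
  have [r0 sr rmax] := rho_max Ts0 n_ge1 m0; apply/andP; split.
    rewrite -[leLHS](powRK s0)// ge0_ler_powR ?nnegrE ?powR_ge0 ?invr_ge0 ?(ltW s0)//.
    exact/rmax/subeigenvalue_trop_pow.
  (* Splitting [rho] as [(rho / N) * N] isolates the tropical subeigenvalue [(rho / N) ^ (1/s)]. *)
  rewrite /rho_root -[rho _](divfK (lt0r_neq0 N0)) powRM ?divr_ge0 ?(ltW N0)//.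
  rewrite mulrC ler_wpM2l ?powR_ge0//.
  exact/tmax/subeigenvalue_pow_trop.
have lim_root : rho_root T s @[s --> +oo] --> rho_trop T.
  apply: (@squeeze_cvgr _ _ _ _ (fun=> rho_trop T)
    (fun s => N `^ s^-1 * rho_trop T)).
  - by near=> s; apply: bounds; near: s; apply: nbhs_pinfty_gt; rewrite num_real.
  - exact: cvg_cst.
  rewrite -[X in _ --> X]mul1r; apply: cvgM; last exact: cvg_cst.
  exact: cvg_powR_invr.
split; first by apply/cvg_ex; exists (rho_trop T).
by rewrite /rho_infty (cvg_lim _ lim_root).
Unshelve. all: by end_near.
Qed.
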